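(* Let $\Pi$ be a projective plane and $(\mathfrak Q,\cdot)$ a quasigroup. The following are equivalent: (a) $L_0(\mathfrak QK_3)$ embeds as points in $\Pi$; (b) $L(\mathfrak QK_3)$ embeds as a dual affine $3$-net in $\Pi$; (c) $L_0(\mathfrak QK_3)$ embeds as lines in the dual plane $\Pi^*$; (d) $L(\mathfrak QK_3)$ embeds as an affine $3$-net in $\Pi^*$; (e) there is a ternary ring $\mathfrak T$ with $\Pi\cong\Pi_{\mathfrak T}$ such that $\mathfrak Q$ is isostrophic to a subquasigroup of $\mathfrak T^+$; (f) there is a ternary ring $\mathfrak T$ with $\Pi\cong\Pi_{\mathfrak T}$ such that $\mathfrak Q$ is isotopic to a subloop of $\mathfrak T^+$; (g) (when $\mathfrak Q$ is a loop) there is a ternary ring $\mathfrak T$ coordinatizing $\Pi$ such that $\mathfrak Q$ is isomorphic to a subloop of $\mathfrak T^+$.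
   Context: Quasigroups: $(\mathfrak Q,\cdot)$ and $(\mathfrak Q',\times)$ are isotopic if there are bijections $\alpha,\beta,\gamma$ with $\alpha(x)\times\beta(y)=\gamma(x\cdot y)$; conjugate if for a fixed permutation $\sigma$ of $\{1,2,3\}$, $x_1\cdot x_2=x_3\iff x_{\sigma(1)}\times x_{\sigma(2)}=x_{\sigma(3)}$; isostrophic if one is conjugate to an isotope of the other. A loop is a quasigroup with identity. Ternary rings: a ternary ring $\mathfrak T$ is a set with ternary operation $t$ and elements $0\ne1$ satisfying (T1) for $a\ne c$ there is a unique $x$ with $t(x,a,b)=t(x,c,d)$; (T2) for any $a,b,c$ a unique $x$ with $t(a,b,x)=c$; (T3) for $a\ne c$ a unique $(x,y)$ with $t(a,x,y)=b$, $t(c,x,y)=d$; (T4) $t(0,a,b)=t(a,0,b)=b$, $t(1,a,0)=t(a,1,0)=a$. Its additive loop is $\mathfrak T^+=(\mathfrak T,+)$ with $a+b:=t(1,a,b)$. The plane $\Pi_{\mathfrak T}$ has points $[x,y],[x],[\infty]$ and lines $\langle m,k\rangle,\langle x\rangle,\langle\infty\rangle$ ($x,y,m,k\in\mathfrak T$) with incidences exactly: $[x,y]\in\langle m,k\rangle\iff t(x,m,k)=y$; $[m]\in\langle m,k\rangle$; $[x,y],[\infty]\in\langle x\rangle$; $[x],[\infty]\in\langle\infty\rangle$. $\mathfrak T$ coordinatizes $\Pi$ if $\Pi\cong\Pi_{\mathfrak T}$. $\Pi^*$ is the dual plane (points and lines interchanged). Quasigroup expansion: $\mathfrak QK_3$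 is the biased graph with nodes $v_1,v_2,v_3$, links $ge_{ij}$ ($g\in\mathfrak Q$, $ij\in\{12,23,13\}$) joining $v_i,v_j$, balanced circles exactly the triangles $\{ge_{12},he_{23},ke_{13}\}$ with $g\cdot h=k$. $E_{ij}=\{ge_{ij}\}$. An edge set is balanced if every circle in it is balanced; $c(S)$ is the number of components of $(\{v_1,v_2,v_3\},S)$. The extended lift matroid $L_0(\mathfrak QK_3)$ has ground set $E(\mathfrak QK_3)\cup\{e_0\}$ ($e_0$ a new element) and rank $\operatorname{rk}S=3-c(S)$ if $S\subseteq E$ is balanced, and $\operatorname{rk}S=3-c(S\setminus\{e_0\})+1$ otherwise. The lift matroid is $L(\mathfrak QK_3)=L_0(\mathfrak QK_3)\setminus e_0$. Embeddings: a matroid embeds as points in a projective plane if there is an injective map from its ground set to points with rank of each set equal to the projective rank of its image (dimension of span plus 1); as lines in $\Pi$ if it embeds as points of $\Pi^*$. An embedding of $L(\mathfrak QK_3)$ as a dual affine $3$-net means an embedding as points such that for each $ij$ the points representing $E_{ij}$ lie on a line $m_{ij}$ (main line), the three main lines are concurrent, and no representing point lies on more than one main line. An embedding of $L(\mathfrak QK_3)$ as an affine $3$-net in $\Pi^*$ means an embedding as lines of $\Pi^*$ such that for each $ij$ the lines representing $E_{ij}$ pass through a common point (center), the three centers being distinct and collinear and each representing line containing exactly one center. *)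

(* Defs.v *)
From mathcomp Require Import all_boot all_fingroup.
From mathcomp Require Import boolp classical_sets.

Set Implicit Arguments.
Unset Strict Implicit.
Unset Printing Implicit Defensive.

Local Open Scope classical_set_scope.

(** * Quasigroups *)

(* Nonemptiness is required: the empty operation is isostrophic to an empty
   subset of every loop but isotopic to no subloop. *)
Definition is_quasigroup (Q : Type) (op : Q -> Q -> Q) : Prop :=
  [/\ inhabited Q,
      forall a b, exists! x, op a x = b
    & forall a b, exists! y, op y a = b].

Definition is_loop (Q : Type) (op : Q -> Q -> Q) : Prop :=
  is_quasigroup op /\ exists e, forall x, op e x = x /\ op x e = x.

Definition isotopic (Q Q' : Type) (op : Q -> Q -> Q) (op' : Q' -> Q' -> Q') :=
  exists alpha beta gamma : Q -> Q',
    [/\ bijective alpha, bijective beta, bijective gamma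
      & forall x y, op' (alpha x) (beta y) = gamma (op x y)].

Definition isomorphic (Q Q' : Type) (op : Q -> Q -> Q) (op' : Q' -> Q' -> Q') :=
  exists2 f : Q -> Q', bijective f & forall x y, f (op x y) = op' (f x) (f y).

Definition i1 : 'I_3 := @Ordinal 3 0 isT.
Definition i2 : 'I_3 := @Ordinal 3 1 isT.
Definition i3 : 'I_3 := @Ordinal 3 2 isT.

(* Conjugate operations live on the same underlying set. *)
Definition conjugate (Q : Type) (op op' : Q -> Q -> Q) : Prop :=
  exists s : {perm 'I_3}, forall x : 'I_3 -> Q,
    op (x i1) (x i2) = x i3 <-> op' (x (s i1)) (x (s i2)) = x (s i3).

Definition conjugate_to_isotope (Q Q' : Type)
    (op : Q -> Q -> Q) (op' : Q' -> Q' -> Q') : Prop :=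
  exists op1 : Q -> Q -> Q,
    [/\ is_quasigroup op1, isotopic op1 op' & conjugate op op1].

Definition isostrophic (Q Q' : Type)
    (op : Q -> Q -> Q) (op' : Q' -> Q' -> Q') : Prop :=
  conjugate_to_isotope op op' \/ conjugate_to_isotope op' op.

Definition op_closed (Q : Type) (op : Q -> Q -> Q) (S : set Q) : Prop :=
  forall x y, S x -> S y -> S (op x y).

Definition sub_op (Q : Type) (op : Q -> Q -> Q) (S : set Q)
    (clS : op_closed op S) (x y : {x : Q | S x}) : {x : Q | S x} :=
  exist _ (op (sval x) (sval y)) (clS _ _ (svalP x) (svalP y)).

(** * Incidence structures and projective planes *)

Record incidence := Incidence {
  pt : Type;
  ln : Type;
  inc : pt -> ln -> Prop }.

Definition dual (P : incidence) : incidence :=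
  @Incidence (ln P) (pt P) (fun l p => inc p l).

Definition isom_incidence (P P' : incidence) : Prop :=
  exists (f : pt P -> pt P') (g : ln P -> ln P'),
    [/\ bijective f, bijective g & forall p l, inc p l <-> inc (f p) (g l)].

Definition collinear (P : incidence) (A : set (pt P)) : Prop :=
  exists l : ln P, forall p, A p -> inc p l.

Definition projective_plane (P : incidence) : Prop :=
  [/\ forall p q : pt P, p <> q -> exists! l, inc p l /\ inc q l,
      forall l m : ln P, l <> m -> exists! p, inc p l /\ inc p m
    & exists p : 'I_4 -> pt P, forall i j k : 'I_4,
        i <> j -> j <> k -> i <> k -> ~ collinear [set p i; p j; p k]].

Definition subspace (P : incidence) (F : set (pt P)) : Prop :=
  forall (p q : pt P) (l : ln P), F p -> F q -> p <> q -> inc p l -> inc q l ->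
    forall r, inc r l -> F r.

Definition span (P : incidence) (A : set (pt P)) : set (pt P) :=
  smallest (@subspace P) A.

(* Dimension plus one of a subspace of a projective plane. *)
Definition subspace_rank (P : incidence) (F : set (pt P)) : nat :=
  if `[< F = set0 >] then 0
  else if `[< exists p, F = [set p] >] then 1
  else if `[< exists l, F = [set p | inc p l] >] then 2
  else 3.

Definition proj_rank (P : incidence) (A : set (pt P)) : nat :=
  subspace_rank (span A).

(** * Ternary rings *)

Record ternary_ring := TernaryRing {
  tcar :> Type;
  tern : tcar -> tcar -> tcar -> tcar;
  tzero : tcar;
  tone : tcar;
  tzero_neq_one : tzero <> tone;
  tern1 : forall a b c d, a <> c -> exists! x, tern x a b = tern x c d;
  tern2 : forall a b c, exists! x, tern a b x = c;
  tern3 : forall a b c d, a <> c ->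
    exists! xy : tcar * tcar, tern a xy.1 xy.2 = b /\ tern c xy.1 xy.2 = d;
  tern4_zerol : forall a b, tern tzero a b = b;
  tern4_zeror : forall a b, tern a tzero b = b;
  tern4_onel : forall a, tern tone a tzero = a;
  tern4_oner : forall a, tern a tone tzero = a }.

Definition tadd (T : ternary_ring) (a b : T) : T := tern (tone T) a b.

Inductive tpoint (T : Type) := PAff of T & T | PSlope of T | PInf.
Inductive tline (T : Type) := LAff of T & T | LVert of T | LInf.
Arguments PInf {T}.
Arguments LInf {T}.

Definition tinc (T : ternary_ring) (p : tpoint T) (l : tline T) : Prop :=
  match p, l with
  | PAff x y, LAff m k => tern x m k = y
  | PSlope m', LAff m _ => m' = m
  | PAff x _, LVert x' => x = x'
  | PInf, LVert _ => True
  | PSlope _, LInf => True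
  | PInf, LInf => True
  | _, _ => False
  end.

Definition tplane (T : ternary_ring) : incidence := Incidence (@tinc T).

Definition coordinatizes (T : ternary_ring) (P : incidence) : Prop :=
  isom_incidence P (tplane T).

(** * Biased graphs and their extended lift matroids

    A biased graph is given by its endpoint map [ends] and the class [B] of its
    balanced circles; a matroid by its rank function. *)

Section BiasedGraph.
Variables (V : finType) (E : Type) (ends : E -> V * V) (B : set (set E)).

Definition joins (e : E) (u v : V) : Prop :=
  ends e = (u, v) \/ ends e = (v, u).

(* Edge sets of the cycles v_0 e_0 v_1 e_1 ... v_n e_n v_0, including digons. *)
Definition circle (C : set E) : Prop :=
  exists (n : nat) (v : 'I_n.+1 -> V) (e : 'I_n.+1 -> E),
    [/\ injective v, injective e,
        forall i, joins (e i) (v i) (v (ordS i)) & C = range e].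

Definition balanced (S : set E) : Prop :=
  forall C, circle C -> C `<=` S -> B C.

Definition ncomp (S : set E) : nat :=
  n_comp (fun u v : V => `[< exists2 e, S e & joins e u v >]) predT.

(* The extra element is [None]. *)
Definition extended_lift_rank (S : set (option E)) : nat :=
  let S0 := Some @^-1` S in
  if `[< ~ S None /\ balanced S0 >] then #|V| - ncomp S0
  else #|V| - ncomp S0 + 1.

Definition lift_rank (S : set E) : nat := extended_lift_rank (Some @` S).

End BiasedGraph.

(** * The quasigroup expansion of the triangle *)

Inductive side := s12 | s23 | s13.

Section QK3.
Variables (Q : Type) (mul : Q -> Q -> Q).

Definition qk3_edge : Type := (Q * side)%type.

Definition qk3_ends (e : qk3_edge) : 'I_3 * 'I_3 :=
  match e.2 with s12 => (i1, i2) | s23 => (i2, i3) | s13 => (i1, i3) end.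

Definition qk3_balanced_circle : set (set qk3_edge) :=
  [set C | exists g h k, mul g h = k /\ C = [set (g, s12); (h, s23); (k, s13)]].

Definition L0_rank : set (option qk3_edge) -> nat :=
  extended_lift_rank qk3_ends qk3_balanced_circle.

Definition L_rank : set qk3_edge -> nat :=
  lift_rank qk3_ends qk3_balanced_circle.

End QK3.

(** * Embeddings *)

Definition point_embedding (G : Type) (rk : set G -> nat) (P : incidence)
    (f : G -> pt P) : Prop :=
  injective f /\ forall S : set G, rk S = proj_rank (f @` S).

Definition line_embedding (G : Type) (rk : set G -> nat) (P : incidence)
    (f : G -> ln P) : Prop :=
  @point_embedding G rk (dual P) f.

Definition embeds_as_points (G : Type) (rk : set G -> nat) (P : incidence) :=
  exists f : G -> pt P, point_embedding rk f.

Definition embeds_as_lines (G : Type) (rk : set G -> nat) (P : incidence) :=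
  exists f : G -> ln P, line_embedding rk f.

Definition embeds_as_dual_affine_3net (Q : Type) (mul : Q -> Q -> Q)
    (P : incidence) : Prop :=
  exists (f : qk3_edge Q -> pt P) (m : side -> ln P),
    [/\ point_embedding (L_rank mul) f,
        injective m,
        forall g s, inc (f (g, s)) (m s),
        exists p, forall s, inc p (m s)
      & forall e s s', inc (f e) (m s) -> inc (f e) (m s') -> s = s'].

Definition embeds_as_affine_3net (Q : Type) (mul : Q -> Q -> Q)
    (P : incidence) : Prop :=
  exists (f : qk3_edge Q -> ln P) (c : side -> pt P),
    [/\ line_embedding (L_rank mul) f,
        injective c,
        forall g s, inc (c s) (f (g, s)),
        collinear (range c)
      & forall e, exists! s, inc (c s) (f e)].

(* Main.v *)
Require Import Defs.
From mathcomp Require Import all_boot all_fingroup.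
From mathcomp Require Import boolp classical_sets.

(** All embedding conditions amount to a "net": three distinct lines [l i]
    through a point [p], and injections [F i] of the quasigroup into the points
    of [l i] other than [p], such that [x1 * x2 = x3] exactly when [F i1 x1],
    [F i2 x2], [F i3 x3] are collinear.  This notion is visibly invariant under
    isotopy and under conjugacy (which permutes the three lines), and
    [a + b = c] in a ternary ring means that [[a]], [[0,b]], [[1,c]] are
    collinear, these points lying on three lines through [[oo]].  Conversely,
    given a net and elements [g0], [h0], coordinatize the plane with
    [[oo] = p], [<oo>, <0>, <1> = l i1, l i2, l i3], [[0] = F i1 g0] and
    [[0,0] = F i2 h0]; the quasigroup then becomes isotopic to a subset of the
    additive loop containing [0].  If it is a loop and [g0 = h0] is its
    identity, the three maps of the isotopism coincide. *)

Set Implicit Arguments.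
Unset Strict Implicit.
Unset Printing Implicit Defensive.

Local Open Scope classical_set_scope.

(** * Ranks *)

Lemma ord3_cases (i : 'I_3) : [\/ i = i1, i = i2 | i = i3].
Proof.
by case: i => [[|[|[|//]]] h]; [constructor 1|constructor 2|constructor 3];
  apply: val_inj.
Qed.

(** Sides are numbered by their place in [mul g h = k], not by their endpoints; conjugacy then acts
    by reindexing the three lines of a net. *)
Definition node_of_side (s : side) : 'I_3 :=
  match s with s12 => i1 | s23 => i2 | s13 => i3 end.

Definition side_of_node (i : 'I_3) : side :=
  match val i with 0 => s12 | 1 => s23 | _ => s13 end.

Lemma node_of_sideK : cancel node_of_side side_of_node.
Proof. by case. Qed.

Lemma side_of_nodeK : cancel side_of_node node_of_side.
Proof. by move=> i; case: (ord3_cases i) => ->. Qed.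

Section Rank.
Variables (P : incidence) (hP : projective_plane P).
Implicit Types (a b p : pt P) (l m : ln P) (A : set (pt P)).

Lemma line_uniq a b l m :
  inc a l -> inc b l -> inc a m -> inc b m -> a = b \/ l = m.
Proof.
move=> al bl am bm; have [|nab] := EM (a = b); first by left.
right; case: hP => /(_ a b nab) [k [_ u]] _ _.
by rewrite -(u l (conj al bl)) (u m (conj am bm)).
Qed.

Lemma line_subspace l : subspace [set p | inc p l].
Proof.
move=> p q m /= pl ql npq pm qm r rm.
by case: (line_uniq pl ql pm qm) => // ->.
Qed.

Lemma proj_rank0 : proj_rank (set0 : set (pt P)) = 0.
Proof.
rewrite /proj_rank /subspace_rank /span smallest_id; first by rewrite asboolT.
by move=> p q l [].
Qed.

Lemma proj_rank1 p : proj_rank [set p] = 1.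
Proof.
rewrite /proj_rank /subspace_rank /span smallest_id.
  rewrite asboolF; last by move/seteqP => [/(_ p erefl)].
  by rewrite asboolT //; exists p.
by move=> a b l -> -> [].
Qed.

Lemma proj_rank2 A a b : collinear A -> A a -> A b -> a <> b -> proj_rank A = 2.
Proof.
move=> [l Al] Aa Ab nab.
have -> : proj_rank A = subspace_rank [set p | inc p l].
  congr subspace_rank; apply/seteqP; split=> [|p pl].
    by apply: smallest_sub => //; apply: line_subspace.
  by move=> F [sF AF]; apply: (sF a b l) => //; [apply: AF..|apply: Al|apply: Al].
rewrite /subspace_rank asboolF; last by move/seteqP => [/(_ a (Al a Aa))].
rewrite asboolF; last first.
  move=> [p /seteqP[s _]]; apply: nab.
  by rewrite (s a (Al a Aa)) (s b (Al b Ab)).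
by rewrite asboolT //; exists l.
Qed.

(** The value 3 is the remaining case of [subspace_rank], so it suffices to exclude that the span is
    empty, a point or a line; [A] lies in its span and already rules out all three. *)
Lemma proj_rank3 A a b : ~ collinear A -> A a -> A b -> a <> b -> proj_rank A = 3.
Proof.
move=> nc Aa Ab nab; have sA : A `<=` span A by apply: sub_gen_smallest.
rewrite /proj_rank /subspace_rank asboolF; last first.
  by move=> e; move: (sA _ Aa); rewrite e.
rewrite asboolF; last first.
  move=> [p e]; apply: nab.
  by move: (sA _ Aa) (sA _ Ab); rewrite e => -> ->.
by rewrite asboolF // => -[l e]; apply: nc; exists l => p /sA; rewrite e.
Qed.

Lemma proj_rank2_collinear A a b :
  proj_rank A = 2 -> A a -> A b -> a <> b -> collinear A.
Proof.
move=> r Aa Ab nab; apply: contrapT => nc.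
by have := proj_rank3 nc Aa Ab nab; rewrite r.
Qed.

End Rank.

(** * Circles, balance and components in the expansion of the triangle *)

Section QuasigroupExpansion.
Variables (Q : Type) (mul : Q -> Q -> Q).
Implicit Types (S : set (qk3_edge Q)) (g h k : Q) (s : side).

Notation ends := (@qk3_ends Q).
Notation bal := (balanced ends (qk3_balanced_circle mul)).

(* Two edges are parallel iff the sums of their end indices agree. *)
Lemma joins_weight (e : qk3_edge Q) (u v : 'I_3) : joins ends e u v ->
  u + v = match e.2 with s12 => 1 | s23 => 3 | s13 => 2 end.
Proof. by case: e => g []; case=> -[<- <-]. Qed.

(** A digon lies on one side, whereas balanced circles meet all three; these circles are what keeps
    parallel edges out of a balanced set. *)
Lemma digon_circle g h s : g <> h -> circle ends [set (g, s); (h, s)].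
Proof.
move=> ngh; exists 1,
  (fun i => if val i == 0 then (ends (g, s)).1 else (ends (g, s)).2),
  (fun i => if val i == 0 then (g, s) else (h, s)); split.
- by case=> [[|[|//]] ?] [[|[|//]] ?] //=; case: s => //= _; apply: val_inj.
- case=> [[|[|//]] ?] [[|[|//]] ?] //= e; try exact: val_inj.
    by case: e => /ngh.
  by case: e => /esym/ngh.
- by case=> [[|[|//]] ?]; [left|right]; case: s.
- apply/seteqP; split=> [x [->|->]|x [i _ <-]].
  + by exists ord0.
  + by exists (Ordinal (isT : 1 < 2)).
  + by case: ifP => _; [left|right].
Qed.

Lemma triangle_circle g h k :
  circle ends [set (g, s12); (h, s23); (k, s13)].
Proof.
exists 2, id, (fun i => nth (k, s13) [:: (g, s12); (h, s23)] i); split=> //.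
- by case=> [[|[|[|//]]] ?] [[|[|[|//]]] ?] //= _; apply: val_inj.
- by case=> [[|[|[|//]]] ?]; [left|left|right]; congr pair; apply: val_inj.
- apply/seteqP; split=> [x [[->|->]|->]|x [[[|[|[|//]]] ?] _ <-]].
  + by exists i1.
  + by exists i2.
  + by exists i3.
  + by left; left.
  + by left; right.
  + by right.
Qed.

(* A circle has at most three edges because its vertices are distinct. *)
Lemma qk3_circleP (C : set (qk3_edge Q)) : circle ends C ->
  (exists g h s, [/\ g <> h, C (g, s) & C (h, s)]) \/
  (exists g h k, C = [set (g, s12); (h, s23); (k, s13)]).
Proof.
move=> [n [v [e [vI eI je ->]]]].
have : #|'I_n.+1| <= #|'I_3| by apply: leq_card vI.
rewrite !card_ord; case: n v e vI eI je => [|[|[|//]]] v e vI eI je _.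
- have := joins_weight (je ord0).
  have -> : ordS ord0 = ord0 :> 'I_1 by apply: val_inj.
  have := je ord0; have -> : ordS ord0 = ord0 :> 'I_1 by apply: val_inj.
  by case: (e ord0) => g [] [] [<-].
- left; pose x : 'I_2 := Ordinal (isT : 1 < 2).
  have := joins_weight (je x); have := joins_weight (je ord0).
  have -> : ordS x = ord0 :> 'I_2 by apply: val_inj.
  have -> : ordS ord0 = x :> 'I_2 by apply: val_inj.
  rewrite addnC => ->; case E0 : (e ord0) => [g s]; case E1 : (e x) => [h s'] /= E.
  have Es : s = s' by case: (s) (s') E => [] [].
  exists g, h, s; split.
  + by move=> egh; have /eI : e ord0 = e x by rewrite E0 E1 egh Es.
  + by rewrite -E0; exists ord0.
  + by rewrite Es -E1; exists x.
- right; have r : range e = [set e i1; e i2; e i3].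
    apply/seteqP; split=> [_ [i _ <-]|_ [[->|->]|->]]; try by eexists.
    by case: (ord3_cases i) => ->; [left; left|left; right|right].
  have := joins_weight (je i1); have := joins_weight (je i2).
  have := joins_weight (je i3).
  have -> : ordS i1 = i2 by apply: val_inj.
  have -> : ordS i2 = i3 by apply: val_inj.
  have -> : ordS i3 = i1 by apply: val_inj.
  have vn (i j : 'I_3) : i != j -> val (v i) <> val (v j).
    by move=> nij /val_inj/vI /eqP; apply/negP.
  have v12 := vn i1 i2 isT; have v13 := vn i1 i3 isT; have v23 := vn i2 i3 isT.
  move=> w3 w2 w1.
  (* Two edges on the same side would have the same end sum; cancelling their common vertex
     identifies the other two. *)
  have s12' : (e i1).2 <> (e i2).2.
    by move=> E; rewrite E in w1; move: w1; rewrite -w2 addnC => /addnI /v13.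
  have s13' : (e i1).2 <> (e i3).2.
    by move=> E; rewrite E in w1; move: w1; rewrite -w3 [RHS]addnC => /addnI /v23.
  have s23' : (e i2).2 <> (e i3).2.
    by move=> E; rewrite E in w2; move: w2; rewrite -w3 [RHS]addnC => /addIn /esym /v12.
  have perm3 (a b c : qk3_edge Q) :
      [/\ [set a; b; c] = [set a; c; b], [set a; b; c] = [set b; a; c],
          [set a; b; c] = [set b; c; a], [set a; b; c] = [set c; a; b]
        & [set a; b; c] = [set c; b; a]].
    by split; apply/seteqP; split=> [x [[->|->]|->]|x [[->|->]|->]];
      rewrite /setU /=; tauto.
  rewrite {}r.
  move: s12' s13' s23'; case: (e i1) (e i2) (e i3) => [g1 t1] [g2 t2] [g3 t3] /=.
  have [p1 p2 p3 p4 p5] := perm3 (g1, t1) (g2, t2) (g3, t3).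
  case: t1 t2 t3 p1 p2 p3 p4 p5 => [] [] [] p1 p2 p3 p4 p5 // _ _ _;
    by [exists g1, g2, g3 | exists g1, g3, g2 | exists g2, g1, g3
       | exists g2, g3, g1 | exists g3, g1, g2 | exists g3, g2, g1].
Qed.

(** Every circle contains two parallel edges or is a full triangle, so balance only has to be tested
    on digons and triangles. *)
Lemma qk3_balancedP S : bal S <->
  (forall s g h, S (g, s) -> S (h, s) -> g = h) /\
  (forall g h k, S (g, s12) -> S (h, s23) -> S (k, s13) -> mul g h = k).
Proof.
split=> [bS|[par tri] C cC CS]; last first.
  case: (qk3_circleP cC) => [[g [h [s [ngh /CS Sg /CS Sh]]]]|[g [h [k E]]]].
    by case: ngh; apply: (par s).
  exists g, h, k; split=> //; apply: tri; apply: CS; rewrite E.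
  - by left; left.
  - by left; right.
  - by right.
split=> [s g h Sg Sh|g h k Sg Sh Sk].
  apply: contrapT => ngh.
  have [|g' [h' [k' [_ /seteqP[_ E]]]]] := bS _ (digon_circle s ngh).
    by move=> x [->|->].
  have E1 : s12 = s by case: (E (g', s12) (or_introl (or_introl erefl))) => -[].
  have E2 : s23 = s by case: (E (h', s23) (or_introl (or_intror erefl))) => -[].
  by rewrite -E1 in E2.
have [|g' [h' [k' [m /seteqP[E _]]]]] := bS _ (triangle_circle g h k).
  by move=> x [[->|->]|->].
have -> : g = g' by case: (E _ (or_introl (or_introl erefl))) => [[]|] [].
have -> : h = h' by case: (E _ (or_introl (or_intror erefl))) => [[]|] [].
by have -> : k = k' by case: (E _ (or_intror erefl)) => [[]|] [].
Qed.

Section Components.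
Variable S : set (qk3_edge Q).

Let adj (u v : 'I_3) : bool := `[< exists2 e, S e & joins ends e u v >].

Let adj_sym : connect_sym adj.
Proof.
apply: sym_connect_sym => u v; apply/asboolP/asboolP => -[e Se [E|E]];
  by exists e => //; first [by right|by left].
Qed.

Let connect_ends e : S e -> connect adj (ends e).1 (ends e).2.
Proof.
move=> Se; apply/connect1/asboolP; exists e => //; left.
by case: (ends e).
Qed.

(** Every component meets [{a, c}], so the whole graph is the closure of these two vertices: one
    component if they are connected, two if not. *)
Let ncomp_cover a c : (forall v, connect adj a v \/ connect adj c v) ->
  ncomp ends S = (~~ connect adj a c).+1.
Proof.
move=> H; rewrite -(n_comp_closure2 adj_sym); apply: eq_n_comp_r => v.
rewrite !inE; apply/esym/negP => /pred0P H0.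
by case: (H v) => cv; [have := H0 a|have := H0 c];
  rewrite !inE eqxx ?orbT andbT /= adj_sym cv.
Qed.

Lemma ncomp_none : (forall e, ~ S e) -> ncomp ends S = 3.
Proof.
move=> S0; rewrite /ncomp -[RHS](card_ord 3); apply: eq_card => u.
rewrite !inE andbT; apply/eqP; symmetry.
have cl : closed adj (pred1 u).
  by move=> x y /asboolP[e /S0].
by have := closed_connect cl (connect_root adj u); rewrite !inE eqxx => /esym/eqP.
Qed.

Lemma ncomp_one g s : S (g, s) -> (forall e, S e -> e.2 = s) -> ncomp ends S = 2.
Proof.
move=> /connect_ends cab Ss.
pose c := match s with s12 => i3 | s23 => i1 | s13 => i2 end.
rewrite (@ncomp_cover (ends (g, s)).1 c); last first.
  move=> v; case: s cab @c {Ss} => /= cab; case: (ord3_cases v) => -> ;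
    by [left; apply: connect0|left; apply: cab|right; apply: connect0].
suff -> : connect adj (ends (g, s)).1 c = false by [].
have cl : closed adj (pred1 c).
  move=> x y /asboolP[[g' s'] /Ss /= ->]; rewrite /c.
  by case: (s) => -[] [<- <-].
apply/negP => /(closed_connect cl); rewrite !inE eqxx /c.
by case: (s).
Qed.

(** Two different sides share a vertex and together reach all three. *)
Lemma ncomp_two e e' : S e -> S e' -> e.2 <> e'.2 -> ncomp ends S = 1.
Proof.
move=> /connect_ends c1 /connect_ends c2 ns.
have H u : connect adj (ends e).1 u.
  have c1' := c1; have c2' := c2; rewrite adj_sym in c1'; rewrite adj_sym in c2'.
  move: ns c1 c2 c1' c2'; case: e e' => g s [g' s'] /= ns.
  case: s s' ns => [] [] //= _; case: (ord3_cases u) => -> c1 c2 c1' c2';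
  solve [exact: connect0 | done | exact: (connect_trans c1 c2)
        | exact: (connect_trans c1 c2') | exact: (connect_trans c1' c2)
        | exact: (connect_trans c2 c1) | exact: (connect_trans c2 c1')].
rewrite (@ncomp_cover (ends e).1 (ends e).1) ?connect0 // => v; by left.
Qed.

End Components.

End QuasigroupExpansion.

(** * Nets and their embeddings *)

(** Index 2 runs past the two-element list, so the default [k] of [nth] is the third entry. *)
Definition triple (T : Type) (g h k : T) (i : 'I_3) : T := nth k [:: g; h] i.

Definition net (P : incidence) (Q : Type) (op : Q -> Q -> Q)
    (p : pt P) (l : 'I_3 -> ln P) (F : 'I_3 -> Q -> pt P) : Prop :=
  [/\ injective l, forall i, inc p (l i), forall i, injective (F i),
      forall i x, inc (F i x) (l i) /\ F i x <> p
    & forall x : 'I_3 -> Q, op (x i1) (x i2) = x i3 <->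
        exists m, forall i, inc (F i (x i)) m].

Definition has_net (P : incidence) (Q : Type) (op : Q -> Q -> Q) : Prop :=
  exists p l F, @net P Q op p l F.

Lemma net_triple P Q op p l F g h k : @net P Q op p l F -> op g h = k <->
  exists m, [/\ inc (F i1 g) m, inc (F i2 h) m & inc (F i3 k) m].
Proof.
move=> [_ _ _ _ /(_ (triple g h k)) /= ->].
split=> [[m H]|[m [h1 h2 h3]]]; exists m.
  by split; [apply: (H i1)|apply: (H i2)|apply: (H i3)].
by move=> i; case: (ord3_cases i) => ->.
Qed.

Section NetEmbedding.
Variables (P : incidence) (hP : projective_plane P).
Variables (Q : Type) (mul : Q -> Q -> Q).
Variables (p : pt P) (l : 'I_3 -> ln P) (F : 'I_3 -> Q -> pt P).
Hypothesis hN : net mul p l F.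

(** The three lines meet pairwise only in [p], and points of the net differ from [p]. *)
Lemma net_main_uniq i j x : inc (F i x) (l j) -> i = j.
Proof.
case: hN => lI pl _ Fl _ Fj; have [Fi np] := Fl i x; apply: lI.
by case: (line_uniq hP (pl i) Fi (pl j) Fj) => // /esym /np.
Qed.

Definition net_point (e : qk3_edge Q) : pt P := F (node_of_side e.2) e.1.

Definition net_point0 (e : option (qk3_edge Q)) : pt P := oapp net_point p e.

Lemma net_point_inj : injective net_point.
Proof.
case: hN => _ _ FI Fl _ [g s] [h t]; rewrite /net_point /= => E.
have st : s = t.
  apply: (can_inj node_of_sideK); apply: (@net_main_uniq _ _ g).
  by rewrite E; case: (Fl (node_of_side t) h).
by rewrite -{}st in E *; rewrite (FI _ _ _ E).
Qed.

Lemma net_point0_inj : injective net_point0.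
Proof.
case: hN => _ _ _ Fl _ [e|] [f|] //= E; first by rewrite (net_point_inj E).
  by case: (Fl (node_of_side e.2) e.1) => _ /(_ E).
by case: (Fl (node_of_side f.2) f.1) => _ /(_ (esym E)).
Qed.

Let main (s : side) : ln P := l (node_of_side s).

Let point_main e : inc (net_point e) (main e.2).
Proof. by case: hN => _ _ _ Fl _; case: (Fl (node_of_side e.2) e.1). Qed.

Let main_uniq e s : inc (net_point e) (main s) -> e.2 = s.
Proof. by move/net_main_uniq/(can_inj node_of_sideK). Qed.

Let main_p s : inc p (main s).
Proof. by case: hN => _ pl _ _ _; apply: pl. Qed.

Let point_neq_p e : net_point e <> p.
Proof. by case: hN => _ _ _ Fl _; case: (Fl (node_of_side e.2) e.1). Qed.

(** A balanced set has at most one edge on each side. If all three sides occur, the triangle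
    relation gives the line; otherwise [e] and [e'] are the only edges. *)
Lemma net_points_collinear (S : set (qk3_edge Q)) e e' :
  balanced (@qk3_ends Q) (qk3_balanced_circle mul) S ->
  S e -> S e' -> e.2 <> e'.2 -> collinear (net_point @` S).
Proof.
move=> /qk3_balancedP[par tri] Se Se' ns.
have Su e1 e2 : S e1 -> S e2 -> e1.2 = e2.2 -> e1 = e2.
  by case: e1 e2 => [g s] [h t] /= Sg Sh E; subst t; rewrite (par _ _ _ Sg Sh).
have [[g [h [k [Sg Sh Sk]]]]|no3] :=
    EM (exists g h k, [/\ S (g, s12), S (h, s23) & S (k, s13)]).
  have [m [m1 m2 m3]] := (net_triple g h k hN).1 (tri _ _ _ Sg Sh Sk).
  exists m => _ [[x s] Sx <-].
  by case: s Sx => Sx;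
    [rewrite (Su _ _ Sx Sg)|rewrite (Su _ _ Sx Sh)|rewrite (Su _ _ Sx Sk)].
have nee : net_point e <> net_point e' by move/net_point_inj => E; rewrite E in ns.
case: hP => /(_ _ _ nee) [m [[me me'] _]] _ _.
exists m => _ [x Sx <-]; have [/(Su _ _ Sx)|n1] := EM (x.2 = e.2).
  by move=> /(_ Se) ->.
have [/(Su _ _ Sx)|n2] := EM (x.2 = e'.2); first by move=> /(_ Se') ->.
case: no3; case: e e' x ns n1 n2 Se Se' Sx {nee me me'} => [a s] [b t] [c u] /=.
case: s t u => [] [] [] // _ _ _ Sa Sb Sc;
  by [exists a, b, c | exists a, c, b | exists b, a, c
     | exists b, c, a | exists c, a, b | exists c, b, a].
Qed.

(** Two parallel edges of [S] would force the line to be a main line, and then [e] and [e'] would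
    lie on the same side; triangles are balanced by the net condition. *)
Lemma net_points_collinear_balanced (S : set (qk3_edge Q)) e e' :
  collinear (net_point @` S) ->
  S e -> S e' -> e.2 <> e'.2 ->
  balanced (@qk3_ends Q) (qk3_balanced_circle mul) S.
Proof.
move=> [L SL] Se Se' ns; have {}SL x : S x -> inc (net_point x) L.
  by move=> Sx; apply: SL; exists x.
apply/qk3_balancedP; split=> [s g h Sg Sh|g h k Sg Sh Sk]; last first.
  apply/(net_triple g h k hN); exists L.
  by split; [apply: (SL (g, s12))|apply: (SL (h, s23))|apply: (SL (k, s13))].
case: (line_uniq hP (SL _ Sg) (SL _ Sh) (point_main (g, s)) (point_main (h, s))).
  by move/net_point_inj => [].
move=> /= E; case: ns.
by rewrite (@main_uniq e s) -?E ?(@main_uniq e' s) -?E //; apply: SL.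
Qed.

Lemma net_points_p_noncollinear (e e' : qk3_edge Q) (L : ln P) :
  inc p L -> inc (net_point e) L -> inc (net_point e') L -> e.2 = e'.2.
Proof.
move=> pL eL e'L.
case: (line_uniq hP (main_p e.2) (point_main e) pL eL) => [/esym/point_neq_p //|E].
by symmetry; apply: main_uniq; rewrite E.
Qed.

(** The number of sides met by [S] decides both ranks: 0 or 1 for no side, 1 or 2 for one side, 2 or
    3 for more. The larger value occurs when [S] contains [None] or its edges are unbalanced. *)
Lemma net_point_embedding : point_embedding (L0_rank mul) net_point0.
Proof.
split=> [|S]; first exact: net_point0_inj.
rewrite /L0_rank /extended_lift_rank card_ord; set S0 := Some @^-1` S.
have im e : S (Some e) -> (net_point0 @` S) (net_point e) by move=> Se; exists (Some e).
have imp : S None -> (net_point0 @` S) p by move=> Sp; exists None.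
have [[[g s] Se]|noe] := EM (exists e, S0 e); last first.
  rewrite ncomp_none; last by move=> e Se; apply: noe; exists e.
  have [Sp|nSp] := EM (S None).
    rewrite asboolF; last by case.
    rewrite (_ : _ @` S = [set p]) ?proj_rank1 //.
    apply/seteqP; split=> [_ [[e|] Se <-] //|_ ->]; last exact: imp.
    by case: noe; exists e.
  rewrite asboolT; last first.
    split=> //; apply/qk3_balancedP.
    by split=> [t g h Sg|g h k Sg]; case: noe; [exists (g, t)|exists (g, s12)].
  rewrite (_ : _ @` S = set0) ?proj_rank0 //.
  apply/seteqP; split=> [_ [[e|] Se <-]|//]; last by case: nSp.
  by case: noe; exists e.
have [[e' [Se' /= ns]]|same] := EM (exists e', S0 e' /\ e'.2 <> s).
  have {}ns : (g, s).2 <> e'.2 by move=> E; apply: ns.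
  rewrite (ncomp_two Se Se' ns).
  have nee : net_point (g, s) <> net_point e'.
    by move/net_point_inj => E; rewrite -E in ns.
  case: asboolP => [[nSp bS]|nb].
    rewrite (@proj_rank2 _ hP _ (net_point (g, s)) (net_point e')) //; try exact: im.
    rewrite (_ : _ @` S = net_point @` S0).
      exact: net_points_collinear bS Se Se' ns.
    by apply/seteqP; split=> [_ [[e|] Sx <-]|_ [e Sx <-]] //; [exists e|exists (Some e)].
  rewrite (@proj_rank3 _ _ (net_point (g, s)) (net_point e')) //; try exact: im.
  move=> [L SL]; apply: nb; split=> [Sp|].
    by apply/ns/(@net_points_p_noncollinear _ _ L); apply: SL; [apply: imp|apply: im..].
  apply: (net_points_collinear_balanced _ Se Se' ns).
  by exists L => _ [e Sx <-]; apply/SL/im.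
have {}same e : S0 e -> e.2 = s.
  by move=> Sx; apply: contrapT => n; apply: same; exists e.
rewrite (ncomp_one Se same).
have cS : collinear (net_point0 @` S).
  exists (main s) => _ [[e|] Sx <-] /=; last exact: main_p.
  by rewrite -(same _ Sx).
case: asboolP => [[nSp /qk3_balancedP[par _]]|nb].
  rewrite (_ : _ @` S = [set net_point (g, s)]) ?proj_rank1 //.
  apply/seteqP; split=> [_ [[[h t]|] Sx <-] //=|_ ->]; last exact: im.
  by have /= E := same _ Sx; subst t; rewrite (par _ _ _ Se Sx).
have [Sp|nSp] := EM (S None).
  rewrite (@proj_rank2 _ hP _ (net_point (g, s)) p) //; [exact: im|exact: imp].
(* Without [p], imbalance on a single side can only come from two parallel edges. *)
suff [h Sh ngh] : exists2 h, S0 (h, s) & g <> h.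
  rewrite (@proj_rank2 _ hP _ (net_point (g, s)) (net_point (h, s))) //; try exact: im.
  by move/net_point_inj => [].
apply: contrapT => H; apply: nb; split=> //; apply/qk3_balancedP.
have Eg h t : S0 (h, t) -> h = g.
  move=> Sh; have /= E := same _ Sh; subst t; apply: contrapT => n.
  by apply: H; exists h => // /esym.
split=> [t x y /Eg -> /Eg -> //|x y z /same /= E /same /=].
by rewrite -E.
Qed.

End NetEmbedding.

(** * Nets and embeddings determine each other *)

Section EmbeddingNet.
Variables (P : incidence) (hP : projective_plane P).
Variables (Q : Type) (mul : Q -> Q -> Q).

Lemma L_rankE (S : set (qk3_edge Q)) : L_rank mul S = L0_rank mul (Some @` S).
Proof. by []. Qed.

Lemma preimage_Some (T : Type) (S : set T) : Some @^-1` (Some @` S) = S.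
Proof. by apply/seteqP; split=> [x [y Sy [<-]]|x Sx] //; exists x. Qed.

Lemma restrict_embedding (f : option (qk3_edge Q) -> pt P) :
  point_embedding (L0_rank mul) f -> point_embedding (L_rank mul) (f \o Some).
Proof.
move=> [fI rf]; split=> [e e' /fI[]//|S].
by rewrite L_rankE rf image_comp.
Qed.

Lemma net_restrict (p : pt P) l F : net mul p l F ->
  point_embedding (L_rank mul) (net_point F).
Proof. by move=> /(net_point_embedding hP) /restrict_embedding. Qed.

Lemma L_rank_triangle g h k : mul g h = k <->
  L_rank mul [set (g, s12); (h, s23); (k, s13)] = 2.
Proof.
rewrite L_rankE /L0_rank /extended_lift_rank card_ord preimage_Some.
set S := [set _; _; _].
have Sg : S (g, s12) by left; left.
have Sh : S (h, s23) by left; right.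
have Sk : S (k, s13) by right.
rewrite (ncomp_two Sg Sh) //; case: asboolP => b.
  by split=> // _; case: b => _ /qk3_balancedP[_]; apply.
split=> // E; case: b; split=> [[]//|]; apply/qk3_balancedP; split.
  by move=> s x y [[|]|] [-> ->] [[|]|] [->].
by move=> x y z [[|]|] [->] // [[|]|] [->] // [[|]|] [->].
Qed.

(** A triangle connects all three vertices, so it has rank 2 if balanced and 3 if not; for the image
    points, rank 2 means collinear. *)
Lemma triangle_collinear f g h k : point_embedding (L_rank mul) f ->
  mul g h = k <-> exists m : ln P,
    [/\ inc (f (g, s12)) m, inc (f (h, s23)) m & inc (f (k, s13)) m].
Proof.
move=> [fI rf]; rewrite L_rank_triangle rf; set S := [set _; _; _].
have Sg : (f @` S) (f (g, s12)) by exists (g, s12) => //; left; left.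
have Sh : (f @` S) (f (h, s23)) by exists (h, s23) => //; left; right.
have Sk : (f @` S) (f (k, s13)) by exists (k, s13) => //; right.
have n : f (g, s12) <> f (h, s23) by move/fI.
split=> [r|[m [mg mh mk]]].
  by have [m mS] := proj_rank2_collinear r Sg Sh n; exists m; split; apply: mS.
by apply: (proj_rank2 hP _ Sg Sh n); exists m => _ [e [[->|->]|->] <-].
Qed.

Lemma embedding_net f (p : pt P) (m : side -> ln P) :
  point_embedding (L_rank mul) f -> injective m -> (forall s, inc p (m s)) ->
  (forall g s, inc (f (g, s)) (m s)) -> (forall e, f e <> p) ->
  net mul p (m \o side_of_node) (fun i x => f (x, side_of_node i)).
Proof.
move=> hf mI pm fm fp; split.
- exact: inj_comp mI (can_inj side_of_nodeK).
- by move=> i; apply: pm.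
- by move=> i x y /hf.1 [].
- by move=> i x; split; [apply: fm|apply: fp].
- move=> x; rewrite (triangle_collinear _ _ _ hf).
  split=> [[M [h1 h2 h3]]|[M H]]; exists M.
    by move=> i; case: (ord3_cases i) => ->.
  by split; [apply: (H i1)|apply: (H i2)|apply: (H i3)].
Qed.

Lemma dual_affine_3net_has_net :
  embeds_as_dual_affine_3net mul P -> has_net P mul.
Proof.
move=> [f [m [hf mI fm [p pm] mu]]]; exists p, (m \o side_of_node).
eexists; apply: (embedding_net hf mI pm fm) => e fe.
(* A represented edge at [p] would lie on two main lines. *)
by have := mu e s12 s23; rewrite fe => /(_ (pm _) (pm _)).
Qed.

Lemma net_dual_affine_3net : has_net P mul -> embeds_as_dual_affine_3net mul P.
Proof.
move=> [p [l [F hN]]]; exists (net_point F), (l \o node_of_side); split.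
- exact: net_restrict hN.
- by case: hN => lI _ _ _ _; apply: inj_comp lI (can_inj node_of_sideK).
- by move=> g s; case: hN => _ _ _ Fl _; case: (Fl (node_of_side s) g).
- by exists p => s; case: hN => _ pl _ _ _; apply: pl.
by move=> e s s' /(net_main_uniq hP hN) E /(net_main_uniq hP hN);
  rewrite E => /(can_inj node_of_sideK).
Qed.

Lemma has_net_L0 : has_net P mul -> embeds_as_points (L0_rank mul) P.
Proof.
by move=> [p [l [F hN]]]; exists (net_point0 p F); apply: net_point_embedding hN.
Qed.

(** The point [p] represents [None], and [m s] joins it to one edge point of side [s]. Rank 2 of
    [None] with two parallel edges puts all of side [s] on [m s]; rank 3 of [None] with edges on two
    sides makes these lines distinct. *)
Lemma L0_has_net : inhabited Q -> embeds_as_points (L0_rank mul) P -> has_net P mul.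
Proof.
move=> [q] [f hf]; pose p := f None; pose a s := f (Some (q, s)).
have pa s : p <> a s by move/hf.1.
have main s : exists l, inc p l /\ inc (a s) l.
  by case: hP => /(_ _ _ (pa s)) [l [H _]] _ _; exists l.
have {main} [m mP] := choice main.
have mp s := (mP s).1; have ma s := (mP s).2.
have col (S : set (option (qk3_edge Q))) x y : S x -> S y -> x <> y ->
    L0_rank mul S = 2 -> collinear (f @` S).
  move=> Sx Sy nxy; rewrite hf.2 => r.
  by apply: (proj_rank2_collinear r) => [||/hf.1]; [exists x|exists y|exact: nxy].
exists p, (m \o side_of_node); eexists.
apply: (embedding_net (restrict_embedding hf)) => // [s t E|g s|e /= /hf.1 //].
  apply: contrapT => nst.
  have := hf.2 [set None; Some (q, s); Some (q, t)].
  have -> : proj_rank (f @` [set None; Some (q, s); Some (q, t)]) = 2.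
    apply: (proj_rank2 hP _ _ _ (pa s)).
    - exists (m s) => _ [x [[->|->]|->] <-].
      + exact: mp.
      + exact: ma.
      + by rewrite E; apply: ma.
    - by exists None => //; left; left.
    - by exists (Some (q, s)) => //; left; right.
  rewrite /L0_rank /extended_lift_rank asboolF; last by case=> [[]]; left; left.
  rewrite (@ncomp_two _ _ (q, s) (q, t)) ?card_ord //; first by left; right.
  by right.
have [->|ngq] := EM (g = q); first exact: ma.
have [||||L LS] := @col [set None; Some (g, s); Some (q, s)] None (Some (q, s)).
- by left; left.
- by right.
- by [].
- rewrite /L0_rank /extended_lift_rank asboolF; last by case=> [[]]; left; left.
  rewrite (@ncomp_one _ _ g s) ?card_ord //; first by left; right.
  by move=> e [[|]|] // [->].
have Li x : [set None; Some (g, s); Some (q, s)] x -> inc (f x) L.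
  by move=> Sx; apply: LS; exists x.
have pL : inc p L by apply: Li; left; left.
have aL : inc (a s) L by apply: Li; right.
case: (line_uniq hP pL aL (mp s) (ma s)) => [/pa //|<-].
by apply: Li; left; right.
Qed.

End EmbeddingNet.

(** With the plane given by its components, its double dual is convertible to it; the conditions on
    centers then read as those on main lines. *)
Lemma affine_3net_dual_iff (pT lT : Type) (i : pT -> lT -> Prop)
    (Q : Type) (mul : Q -> Q -> Q) :
  embeds_as_affine_3net mul (dual (Incidence i)) <->
  embeds_as_dual_affine_3net mul (Incidence i).
Proof.
split=> [[f [c [hf cI fc [p pc] cu]]]|[f [m [hf mI fm [p pm] mu]]]].
  exists f, c; split=> //; first by exists p => s; apply: pc; exists s.
  move=> e s s' fs fs'; have [t [_ tu]] := cu e.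
  by rewrite -(tu _ fs) (tu _ fs').
exists f, m; split=> //; first by exists p => _ [s _ <-]; apply: pm.
by move=> [g s]; exists s; split=> [|s' fs']; [apply: fm|apply: mu fs'; apply: fm].
Qed.

(** * Transport of nets *)

Lemma inj_surj_bijective (A B : Type) (f : A -> B) :
  injective f -> (forall b, exists a, f a = b) -> bijective f.
Proof.
by move=> fI /choice[g gK]; exists g => // a; apply: fI; rewrite gK.
Qed.

Lemma sval_inj (A : Type) (S : set A) : injective (@sval A S).
Proof.
by move=> [x Sx] [y Sy] /= E; subst y; congr exist; apply: Prop_irrelevance.
Qed.

Lemma isotopic_sym (Q Q' : Type) (op : Q -> Q -> Q) (op' : Q' -> Q' -> Q') :
  isotopic op op' -> isotopic op' op.
Proof.
move=> [a [b [c [[a' aK a'K] [b' bK b'K] [c' cK c'K] H]]]].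
exists a', b', c'; split; [by exists a|by exists b|by exists c|].
by move=> x y; rewrite -{2}(a'K x) -{2}(b'K y) H cK.
Qed.

Lemma isotopic_quasigroup (Q Q' : Type) (op : Q -> Q -> Q) (op' : Q' -> Q' -> Q') :
  isotopic op op' -> is_quasigroup op -> is_quasigroup op'.
Proof.
move=> [a [b [c [[a' aK a'K] [b' bK b'K] [c' cK c'K] H]]]] [[q] dr dl].
split=> [|x y|x y]; first by split; exact: (a q).
  have [z [zE zU]] := dr (a' x) (c' y); exists (b z); split.
    by rewrite -{1}(a'K x) H zE c'K.
  move=> w wE; rewrite -(b'K w); congr b; apply: zU.
  by apply: (can_inj cK); rewrite -H a'K b'K wE c'K.
have [z [zE zU]] := dl (b' x) (c' y); exists (a z); split.
  by rewrite -{1}(b'K x) H zE c'K.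
move=> w wE; rewrite -(a'K w); congr a; apply: zU.
by apply: (can_inj cK); rewrite -H a'K b'K wE c'K.
Qed.

Lemma conjugate_refl (Q : Type) (op : Q -> Q -> Q) : Defs.conjugate op op.
Proof. by exists 1%g => x; rewrite !perm1. Qed.

Lemma conjugate_sym (Q : Type) (op op' : Q -> Q -> Q) :
  Defs.conjugate op op' -> Defs.conjugate op' op.
Proof.
move=> [s H]; exists (s^-1)%g => x.
by rewrite (H (x \o (s^-1)%g)) /= !permK.
Qed.

Lemma isom_incidence_sym (P P' : incidence) :
  isom_incidence P P' -> isom_incidence P' P.
Proof.
move=> [f [g [[f' fK f'K] [g' gK g'K] H]]].
exists f', g'; split; [by exists f|by exists g|].
by move=> p l; rewrite H f'K g'K.
Qed.

Lemma isotopic_has_net P (Q Q' : Type) (op : Q -> Q -> Q) (op' : Q' -> Q' -> Q') :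
  isotopic op op' -> has_net P op' -> has_net P op.
Proof.
move=> [a [b [c [/bij_inj aI /bij_inj bI /bij_inj cI H]]]].
move=> [p [l [F [lI pl FI Fl N]]]].
exists p, l, (fun i => F i \o triple a b c i); split=> //.
- by move=> i; apply: inj_comp (FI i) _; case: (ord3_cases i) => ->.
- by move=> i x; apply: Fl.
move=> x; have <- := N (fun i => triple a b c i (x i)).
by rewrite /triple /= H; split=> [->//|/cI].
Qed.

(** Lines and labellings are permuted by the inverse of [s], because the condition for [op'] is read
    at [x \o s]. *)
Lemma conjugate_has_net P (Q : Type) (op op' : Q -> Q -> Q) :
  Defs.conjugate op op' -> has_net P op' -> has_net P op.
Proof.
move=> [s H] [p [l [F [lI pl FI Fl N]]]].
exists p, (l \o (s^-1)%g), (fun i => F ((s^-1)%g i)); split.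
- exact: inj_comp lI perm_inj.
- by move=> i; apply: pl.
- by move=> i; apply: FI.
- by move=> i x; apply: Fl.
move=> x; rewrite H (N (x \o s)).
split=> -[m Hm]; exists m => i; last by have := Hm (s i); rewrite permK.
by have := Hm ((s^-1)%g i); rewrite /= permKV.
Qed.

Lemma isom_net P P' (f : pt P -> pt P') (g : ln P -> ln P') Q
    (op : Q -> Q -> Q) p l F :
  bijective f -> bijective g -> (forall p l, inc p l <-> inc (f p) (g l)) ->
  net op p l F -> net op (f p) (g \o l) (fun i x => f (F i x)).
Proof.
move=> /bij_inj fI gB H [lI pl FI Fl N]; split.
- exact: inj_comp (bij_inj gB) lI.
- by move=> i; apply/H.
- by move=> i; apply: inj_comp fI (FI i).
- move=> i x; have [Fi Fn] := Fl i x; split; first by apply/H.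
  by move/fI.
move=> x; rewrite N; split=> -[m Hm]; first by exists (g m) => i; apply/H.
by case: gB => g' gK g'K; exists (g' m) => i; apply/H; rewrite g'K.
Qed.

Lemma isom_has_net P P' Q (op : Q -> Q -> Q) :
  isom_incidence P P' -> has_net P op -> has_net P' op.
Proof.
move=> [f [g [fB gB H]]] [p [l [F hN]]].
by exists (f p), (g \o l), (fun i x => f (F i x)); apply: isom_net.
Qed.

Lemma tplane_has_net (T : ternary_ring) (S : set T) (clS : op_closed (@tadd T) S) :
  has_net (tplane T) (sub_op clS).
Proof.
pose l : 'I_3 -> tline T := triple LInf (LVert (tzero T)) (LVert (tone T)).
pose F (i : 'I_3) (x : {x : T | S x}) : tpoint T :=
  triple (PSlope (sval x)) (PAff (tzero T) (sval x)) (PAff (tone T) (sval x)) i.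
have n01 := @tzero_neq_one T.
have n10 : tone T <> tzero T by move/esym.
exists (PInf : pt (tplane T)), l, F; split.
- by move=> i j; case: (ord3_cases i) => ->; case: (ord3_cases j) => -> //= [].
- by move=> i; case: (ord3_cases i) => ->.
- move=> i x y; case: (ord3_cases i) => ->; rewrite /F /triple /= => -[];
  by move/sval_inj.
- by move=> i x; case: (ord3_cases i) => ->; split.
(* Points at infinity other than [PInf] are on no vertical line, and affine points are not on
   [LInf]; so a line through the three points has a slope and an intercept. *)
move=> x; split=> [E|[[m k H|v|]]].
- exists (LAff (sval (x i1)) (sval (x i2))) => i.
  by case: (ord3_cases i) => ->; rewrite /F /triple -?E //=; apply: tern4_zerol.
- have := H i1; have := H i2; have := H i3; rewrite /F /triple /=.
  rewrite tern4_zerol => E3 E2 E1; apply: sval_inj.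
  by rewrite /= /tadd -E3 -E2 E1.
- by move=> /(_ i1).
- by move=> /(_ i2).
Qed.

Lemma isostrophic_has_net P (Q Q' : Type) (op : Q -> Q -> Q) (op' : Q' -> Q' -> Q') :
  isostrophic op op' -> has_net P op' -> has_net P op.
Proof.
move=> [] [op1 [_ hi hc]] hn.
  by apply: (conjugate_has_net hc); apply: (isotopic_has_net hi).
apply: (isotopic_has_net (isotopic_sym hi)).
exact: conjugate_has_net (conjugate_sym hc) hn.
Qed.

Lemma subquasigroup_has_net P (Q : Type) (mul : Q -> Q -> Q) :
  (exists T : ternary_ring, coordinatizes T P /\
     exists (S : set T) (clS : op_closed (@tadd T) S),
       is_quasigroup (sub_op clS) /\ isostrophic mul (sub_op clS)) ->
  has_net P mul.
Proof.
move=> [T [/isom_incidence_sym iso [S [clS [_ ism]]]]].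
exact: isom_has_net iso (isostrophic_has_net ism (tplane_has_net clS)).
Qed.

Lemma isotopic_isostrophic (Q Q' : Type) (op : Q -> Q -> Q) (op' : Q' -> Q' -> Q') :
  is_quasigroup op -> isotopic op op' -> isostrophic op op'.
Proof. by move=> hq hi; left; exists op; split=> //; apply: conjugate_refl. Qed.

Lemma isomorphic_isotopic (Q Q' : Type) (op : Q -> Q -> Q) (op' : Q' -> Q' -> Q') :
  isomorphic op op' -> isotopic op op'.
Proof. by move=> [f fB H]; exists f, f, f; split. Qed.

(** On these three lines the net points have the form [[a x]], [[0, b y]], [[1, c z]], so
    collinearity says [a x + b y = c (mul x y)]. As [a g0] and [b h0] are 0, the maps [a] and [b]
    are [c] after a translation of [Q]; all three have the same range, which contains 0. *)
Lemma tplane_net_subloop (T : ternary_ring) (Q : Type) (mul : Q -> Q -> Q)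
    (hQ : is_quasigroup mul) (l : 'I_3 -> ln (tplane T)) F (g0 h0 : Q) :
  net mul (PInf : pt (tplane T)) l F ->
  l i1 = LInf -> l i2 = LVert (tzero T) -> l i3 = LVert (tone T) ->
  F i1 g0 = PSlope (tzero T) -> F i2 h0 = PAff (tzero T) (tzero T) ->
  exists (S : set T) (clS : op_closed (@tadd T) S) (a b c : Q -> {x | S x}),
    [/\ is_loop (sub_op clS), [/\ bijective a, bijective b & bijective c],
        forall x y, sub_op clS (a x) (b y) = c (mul x y),
        forall x, a x = c (mul x h0) & forall y, b y = c (mul g0 y)].
Proof.
move=> hN l1 l2 l3 Fg Fh.
have [_ _ FI Fl _] := hN.
have /choice[a aE] : forall x, exists a, F i1 x = PSlope a.
  move=> x; have := Fl i1 x; rewrite l1.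
  by case: (F i1 x) => [? ?|m|] [] //; exists m.
have /choice[b bE] : forall x, exists b, F i2 x = PAff (tzero T) b.
  move=> x; have := Fl i2 x; rewrite l2.
  by case: (F i2 x) => [? y|m|] [] //= ->; exists y.
have /choice[c cE] : forall x, exists c, F i3 x = PAff (tone T) c.
  move=> x; have := Fl i3 x; rewrite l3.
  by case: (F i3 x) => [? y|m|] [] //= ->; exists y.
have add x y : tadd (a x) (b y) = c (mul x y).
  have [m []] := (net_triple x y (mul x y) hN).1 erefl.
  rewrite aE bE cE; case: m => [m k| |] //=.
  by rewrite tern4_zerol => -> ->.
have a0 : a g0 = tzero T by move: (aE g0); rewrite Fg => -[].
have b0 : b h0 = tzero T by move: (bE h0); rewrite Fh => -[].
have ac x : a x = c (mul x h0).
  by rewrite -add b0 /tadd tern4_onel.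
have bc y : b y = c (mul g0 y).
  by rewrite -add a0 /tadd tern4_zeror.
have cI : injective c by move=> x y E; apply: (FI i3); rewrite !cE E.
have [_ dr dl] := hQ.
have clS : op_closed (@tadd T) (range c).
  move=> _ _ [u _ <-] [v _ <-].
  (* Every element of [Q] is some [mul x h0] and some [mul g0 y], so a sum of two values of [c] has
     the form [a x + b y]. *)
  have [x [<- _]] := dl h0 u; have [y [<- _]] := dr g0 v.
  by rewrite -ac -bc add; eexists.
pose c' x : {y | range c y} := exist _ (c x) (imageT c x).
have c'B : bijective c'.
  apply: inj_surj_bijective => [x y [] /cI //|[y Sy]].
  by have [x _ E] : range c y by []; exists x; apply: sval_inj.
have a'B : bijective (fun x => c' (mul x h0)).
  apply: (bij_comp c'B); apply: inj_surj_bijective => [x y E|y].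
    by have [z [_ u]] := dl h0 (mul y h0); rewrite -(u x E) -(u y erefl).
  by have [x [xE _]] := dl h0 y; exists x.
have b'B : bijective (fun y => c' (mul g0 y)).
  apply: (bij_comp c'B); apply: inj_surj_bijective => [x y E|y].
    by have [z [_ u]] := dr g0 (mul g0 y); rewrite -(u x E) -(u y erefl).
  by have [x [xE _]] := dr g0 y; exists x.
have H x y : sub_op clS (c' (mul x h0)) (c' (mul g0 y)) = c' (mul x y).
  by apply: sval_inj; rewrite /= -ac -bc add.
exists (range c), clS, (fun x => c' (mul x h0)), (fun y => c' (mul g0 y)), c'.
split=> //; split.
  apply: (isotopic_quasigroup _ hQ).
  by do 3 eexists; split; [exact: a'B|exact: b'B|exact: c'B|].
(* This element is [a g0], that is, 0. *)
exists (c' (mul g0 h0)) => -[x Sx]; split; apply: sval_inj => /=;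
  by rewrite -ac a0 /tadd ?tern4_zeror ?tern4_onel.
Qed.

(** * Coordinates *)

Section Coordinates.
Variables (P : incidence) (hP : projective_plane P).
Variables (join : pt P -> pt P -> ln P) (meet : ln P -> ln P -> pt P).
Hypotheses (joinl : forall a b, inc a (join a b))
  (joinr : forall a b, inc b (join a b))
  (meetl : forall l m, inc (meet l m) l)
  (meetr : forall l m, inc (meet l m) m).

Lemma line_eq (a b : pt P) (l m : ln P) :
  a <> b -> inc a l -> inc b l -> inc a m -> inc b m -> l = m.
Proof. by move=> n al bl am bm; case: (line_uniq hP al bl am bm). Qed.

(** The point [q] certifies that the two lines differ. *)
Lemma point_eq (q a b : pt P) (l m : ln P) : inc q l -> ~ inc q m ->
  inc a l -> inc b l -> inc a m -> inc b m -> a = b.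
Proof.
by move=> ql qm al bl am bm; case: (line_uniq hP al bl am bm) => // E; rewrite E in ql.
Qed.

Variables (p : pt P) (linf l0 : ln P).
Hypotheses (pinf : inc p linf) (p0 : inc p l0) (ninf0 : linf <> l0).

Lemma concurrent_meet (l m : ln P) a :
  l <> m -> inc p l -> inc p m -> inc a l -> inc a m -> a = p.
Proof. by move=> n pl pm al am; case: (line_uniq hP al pl am pm). Qed.

(* [K], [M] and [V] label the affine points of [l0 = <0>], the affine points of
   [linf] and the lines of the pencil of [p] other than [linf] by elements of
   [T], giving the points [[0,k]], [[m]] and the lines [<x>]; then
   [A x y = [x,y]] and [L m k = <m,k>].  (T1)-(T3) hold for any such labels,
   and [N1], [N2] encode the normalizations [t(1,a,0) = a = t(a,1,0)]. *)
Section Ternary.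
Variables (T : Type) (K M : T -> pt P) (V : T -> ln P) (o e : T).
Hypotheses (noe : o <> e)
  (K0 : forall a, inc (K a) l0) (Kp : forall a, K a <> p) (KI : injective K)
  (Ks : forall q, inc q l0 -> q <> p -> exists a, K a = q)
  (Minf : forall a, inc (M a) linf) (Mp : forall a, M a <> p) (MI : injective M)
  (Ms : forall q, inc q linf -> q <> p -> exists a, M a = q)
  (Vp : forall a, inc p (V a)) (Vinf : forall a, V a <> linf) (VI : injective V)
  (Vs : forall l, inc p l -> l <> linf -> exists a, V a = l)
  (Vo : V o = l0).

(** The horizontal line at height [y]; it is [L o y] by conversion, so facts about [L] apply to
    it. *)
Let H (y : T) : ln P := join (M o) (K y).
Let A (x y : T) : pt P := meet (V x) (H y).
Let L (m k : T) : ln P := join (M m) (K k).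

Hypotheses (N1 : forall a, inc (A e a) (L a o)) (N2 : forall a, inc (A a a) (L e o)).

Let p_L m k : ~ inc p (L m k).
Proof.
move=> pL; have E := line_eq (@Mp m) (joinl _ _) pL (Minf m) pinf.
apply: (@Kp k); apply: (concurrent_meet ninf0) => //.
by rewrite -E; apply: joinr.
Qed.

Let p_H y : ~ inc p (H y). Proof. exact: p_L. Qed.

Let A_inf x y : ~ inc (A x y) linf.
Proof.
move=> Ai; apply: (@p_H y).
by rewrite -(concurrent_meet (@Vinf x) (Vp x) pinf (meetl _ _) Ai); apply: meetr.
Qed.

Let A_p x y : A x y <> p. Proof. by move=> E; apply: (@A_inf x y); rewrite E. Qed.

Let L_inj m k m' k' : L m k = L m' k' -> m = m' /\ k = k'.
Proof.
move=> E; have jl : inc (M m') (L m k) by rewrite E; apply: joinl.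
have jr : inc (K k') (L m k) by rewrite E; apply: joinr.
split.
  by apply: MI; apply: (point_eq pinf (@p_L m k)) => //; apply: joinl.
by apply: KI; apply: (point_eq p0 (@p_L m k)) => //; apply: joinr.
Qed.

Let L_surj l : ~ inc p l -> exists m k, L m k = l.
Proof.
move=> pl.
have [|m mE] := @Ms (meet linf l) (meetl _ _); first by move=> E; apply: pl; rewrite -E.
have [|k kE] := @Ks (meet l0 l) (meetl _ _); first by move=> E; apply: pl; rewrite -E.
exists m, k; apply: (@line_eq (M m) (K k)); try by [apply: joinl|apply: joinr].
- move=> E; apply: (@Mp m); apply: (concurrent_meet ninf0) => //.
  by rewrite E.
- by rewrite mE.
- by rewrite kE.
Qed.

Let V_A x x' y : inc (A x y) (V x') -> x = x'.
Proof.
by move=> h; apply: VI; apply: (line_eq (@A_p x y)) => //; apply: meetl.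
Qed.

Let A_inj x y x' y' : A x y = A x' y' -> x = x' /\ y = y'.
Proof.
move=> E; have xx : x = x' by apply: (@V_A _ _ y); rewrite E; apply: meetl.
split=> //; have Eh : H y = H y'.
  apply: (@line_eq (A x y) (M o)); try exact: joinl.
  - by move=> E'; apply: (@A_inf x y); rewrite E'.
  - exact: meetr.
  - by rewrite E; apply: meetr.
by case: (@L_inj o y o y' Eh).
Qed.

(** The abscissa comes from the line through [R] and [p], the ordinate from the line through [R] and
    [M o]. *)
Let A_surj R : ~ inc R linf -> exists x y, A x y = R.
Proof.
move=> Ri; have nRp : R <> p by move=> E; apply: Ri; rewrite E.
have [|x xE] := @Vs (join R p) (joinr _ _).
  by move=> E; apply: Ri; rewrite -E.
have pj : ~ inc p (join (M o) R).
  move=> pj; apply: Ri.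
  by rewrite -(line_eq (@Mp o) (joinl _ R) pj (Minf o) pinf).
have [m [k E]] := L_surj pj.
have mo : m = o.
  apply: MI; apply: (point_eq pinf pj) => //.
  by rewrite -E; apply: joinl.
exists x, k; apply: (point_eq (@Vp x) (@p_H k)); rewrite ?xE //.
- by rewrite -xE; apply: meetl.
- exact: meetr.
- by rewrite /H -/(L o k) -mo E.
Qed.

Let tern_ex x m k : exists y, inc (A x y) (L m k).
Proof.
have [|x' [y E]] := @A_surj (meet (V x) (L m k)).
  move=> Ri; apply: (@p_L m k).
  by rewrite -(concurrent_meet (@Vinf x) (Vp x) pinf (meetl _ _) Ri).
exists y; have <- : x' = x by apply: (@V_A _ _ y); rewrite E.
by rewrite E.
Qed.

Let t x m k : T := sval (cid (tern_ex x m k)).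

Let tP x m k y : t x m k = y <-> inc (A x y) (L m k).
Proof.
rewrite /t; case: cid => /= z Az; split=> [<- //|Ay].
have E : A x z = A x y.
  by apply: (point_eq (@Vp x) (@p_L m k)) => //; apply: meetl.
by case: (A_inj E).
Qed.

(** Lines of different slopes meet in an affine point, since a meeting point on [linf] would be
    equal to both slope points. *)
Let t1 a b c d : a <> c -> exists! x, t x a b = t x c d.
Proof.
move=> nac; have nL : L a b <> L c d by move/L_inj => [].
have Ml m k : inc (M m) (L m k) by apply: joinl.
have [|x [y E]] := @A_surj (meet (L a b) (L c d)).
  move=> Ri; apply: nac; apply: MI.
  rewrite (@point_eq p (M a) (meet (L a b) (L c d)) linf (L a b)) //.
  by rewrite (@point_eq p (M c) (meet (L a b) (L c d)) linf (L c d)).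
exists x; split.
  have -> : t x a b = y by apply/tP; rewrite E.
  by symmetry; apply/tP; rewrite E.
move=> x' /esym/tP h.
have h' : inc (A x' (t x' a b)) (L a b) by apply/tP.
have EA : A x y = A x' (t x' a b).
  by case: (@line_uniq _ hP (A x y) (A x' (t x' a b)) (L a b) (L c d)) => //; rewrite E.
by case: (A_inj EA).
Qed.

(** The solution is the intercept of the line through [[a,c]] with slope [b]. *)
Let t2 a b c : exists! x, t a b x = c.
Proof.
have Ml m k : inc (M m) (L m k) by apply: joinl.
have nAM : A a c <> M b by move=> E; apply: (@A_inf a c); rewrite E.
have [|m [k E]] := @L_surj (join (A a c) (M b)).
  move=> pj; apply: (@A_inf a c).
  by rewrite -(line_eq (@Mp b) (joinr (A a c) _) pj (Minf b) pinf).
have mb : m = b.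
  by apply: MI; apply: (point_eq pinf (@p_L m k)) => //; rewrite E.
subst m; exists k; split; first by apply/tP; rewrite E.
move=> k' /tP h; have /L_inj[//] : L b k = L b k'.
by apply: (line_eq nAM) => //; rewrite E.
Qed.

(** The solution describes the line joining [[a,b]] and [[c,d]], which avoids [p] because the
    abscissas differ. *)
Let t3 a b c d : a <> c ->
  exists! xy : T * T, t a xy.1 xy.2 = b /\ t c xy.1 xy.2 = d.
Proof.
move=> nac; have nAA : A a b <> A c d by move/A_inj => [].
have [|m [k E]] := @L_surj (join (A a b) (A c d)).
  move=> pj; apply: nac; apply: VI.
  have -> : V a = join (A a b) (A c d).
    by apply: (line_eq (@A_p a b)) => //; apply: meetl.
  by apply: (line_eq (@A_p c d)) => //; apply: meetl.
exists (m, k); split; first by split; apply/tP; rewrite /= E.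
move=> [m' k'] /= [/tP h1 /tP h2]; have /L_inj[-> -> //] : L m k = L m' k'.
by apply: (line_eq nAA) => //; rewrite E.
Qed.

Let A_oK b : A o b = K b.
Proof.
rewrite /A Vo; apply: (point_eq p0 (@p_H b)) => //; exact: joinr.
Qed.

Let t_ol a b : t o a b = b.
Proof. by apply/tP; rewrite A_oK; apply: joinr. Qed.

Let t_or a b : t a o b = b.
Proof. by apply/tP; apply: meetr. Qed.

Let t_el a : t e a o = a. Proof. exact/tP. Qed.

Let t_er a : t a e o = a. Proof. exact/tP. Qed.

Definition coordinate_ring : ternary_ring :=
  TernaryRing noe t1 t2 t3 t_ol t_or t_el t_er.

Let phi (q : tpoint T) : pt P :=
  match q with PAff x y => A x y | PSlope m => M m | PInf => p end.

Let psi (l : tline T) : ln P :=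
  match l with LAff m k => L m k | LVert x => V x | LInf => linf end.

Let phi_bij : bijective phi.
Proof.
apply: inj_surj_bijective => [[x y|m|] [x' y'|m'|] //= E|q].
- by case: (A_inj E) => -> ->.
- by case: (@A_inf x y); rewrite E.
- by case: (@A_inf x y); rewrite E.
- by case: (@A_inf x' y'); rewrite -E.
- by rewrite (MI E).
- by case: (@Mp m).
- by case: (@A_inf x' y'); rewrite -E.
- by case: (@Mp m').
have [qi|/A_surj[x [y <-]]] := EM (inc q linf); last by exists (PAff x y).
have [->|/(Ms qi)[m <-]] := EM (q = p); first by exists PInf.
by exists (PSlope m).
Qed.

Let psi_bij : bijective psi.
Proof.
have LV m k x : L m k <> V x by move=> E; apply: (@p_L m k); rewrite E.
have Li m k : L m k <> linf by move=> E; apply: (@p_L m k); rewrite E.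
apply: inj_surj_bijective => [[m k|x|] [m' k'|x'|] //= E|l].
- by case: (L_inj E) => -> ->.
- by case: (LV _ _ _ E).
- by case: (Li _ _ E).
- by case: (LV _ _ _ (esym E)).
- by rewrite (VI E).
- by case: (Vinf E).
- by case: (Li _ _ (esym E)).
- by case: (Vinf (esym E)).
have [pl|/L_surj[m [k <-]]] := EM (inc p l); last by exists (LAff m k).
have [->|/(Vs pl)[x <-]] := EM (l = linf); first by exists LInf.
by exists (LVert x).
Qed.

Let phi_psi (q : tpoint T) (l : tline T) :
  @tinc coordinate_ring q l <-> inc (phi q) (psi l).
Proof.
case: q l => [x y|m|] [m' k|x'|] //=.
- by split=> [->|/V_A //]; apply: meetl.
- by split=> // /A_inf.
- split=> [->|h]; first exact: joinl.
  by apply: MI; apply: (point_eq pinf (@p_L m' k)) => //; apply: joinl.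
- split=> // h; apply: (@Mp m).
  by apply: (concurrent_meet (@Vinf x')).
- by split=> // /p_L.
Qed.

Lemma coordinate_ring_exists : exists (R : ternary_ring)
    (f : tpoint R -> pt P) (g : tline R -> ln P),
  [/\ bijective f, bijective g,
      forall q l, @tinc R q l <-> inc (f q) (g l),
      [/\ f PInf = p, f (PSlope (tzero R)) = M o
        & f (PAff (tzero R) (tzero R)) = K o]
    & [/\ g LInf = linf, g (LVert (tzero R)) = l0 & g (LVert (tone R)) = V e]].
Proof.
exists coordinate_ring, phi, psi; split=> //.
by split=> //=; apply: A_oK.
Qed.

End Ternary.

Lemma perspective_line (O a q : pt P) (l : ln P) :
  inc q l -> ~ inc O l -> inc a l -> a <> q -> ~ inc q (join O a).
Proof.
move=> ql Ol al naq qj; apply: Ol.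
by rewrite -(line_eq naq (joinr O a) qj al ql); apply: joinl.
Qed.

(** The line from [O] to [a] misses [p] and is also the line from [O] to its point on [m];
    projecting back along it returns [a]. *)
Lemma perspectivity (O a : pt P) (l m : ln P) :
  inc p l -> inc p m -> ~ inc O l -> ~ inc O m -> inc a l -> a <> p ->
  meet m (join O a) <> p /\ meet l (join O (meet m (join O a))) = a.
Proof.
move=> pl pm Ol Om al nap; have pj := perspective_line pl Ol al nap.
split=> [E|]; first by apply: pj; rewrite -E.
have nO : O <> meet m (join O a) by move=> E; apply: Om; rewrite E.
rewrite -(line_eq nO (joinl _ a) (meetr _ _) (joinl _ _) (joinr _ _)).
exact: (point_eq pl pj).
Qed.

(** * Labellings constructed from a frame *)

Section Frame.
Variables (l1 : ln P) (X Y : pt P).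
Hypotheses (p1 : inc p l1) (ninf1 : linf <> l1) (n01 : l0 <> l1)
  (Xinf : inc X linf) (Xp : X <> p) (Y0 : inc Y l0) (Yp : Y <> p).

(** The ring consists of the points of [l0] other than [p], with [Y] as zero and any other such
    point as one; [K] is then the inclusion. *)
Let T := {a : pt P | inc a l0 /\ a <> p}.
Let K (a : T) : pt P := sval a.
Let o : T := exist _ Y (conj Y0 Yp).

Variable e : T.
Hypothesis noe : o <> e.

Let K0 (a : T) : inc (K a) l0. Proof. by case: (svalP a). Qed.
Let Kp (a : T) : K a <> p. Proof. by case: (svalP a). Qed.
Let KI : injective K. Proof. exact: sval_inj. Qed.
Let Ks q : inc q l0 -> q <> p -> exists a, K a = q.
Proof. by move=> q0 qp; exists (exist _ q (conj q0 qp)). Qed.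

Let X0 : ~ inc X l0. Proof. by move/(concurrent_meet ninf0 pinf p0 Xinf). Qed.
Let X1 : ~ inc X l1. Proof. by move/(concurrent_meet ninf1 pinf p1 Xinf). Qed.
Let Y1 : ~ inc Y l1. Proof. by move/(concurrent_meet n01 p0 p1 Y0). Qed.
Let Yinf : ~ inc Y linf.
Proof. by move=> h; apply: Yp; apply: (concurrent_meet ninf0). Qed.

(* [R a = [1,a]] is projected from [X] and [D a = [a,a]] lies on the line [I] of
   slope [1]. *)
Let H (a : T) : ln P := join X (K a).
Let R (a : T) : pt P := meet l1 (H a).
(** The slope of the line from the origin [Y] to [[1,a]], which amounts to [t(1,a,0) = a]. *)
Let M (a : T) : pt P := meet linf (join Y (R a)).
Let I : ln P := join Y (R e).
Let D (a : T) : pt P := meet I (H a).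
(** Giving [D a] the abscissa [a] amounts to [t(a,1,0) = a]. *)
Let V (a : T) : ln P := join p (D a).

Let RP a : R a <> p /\ meet l0 (join X (R a)) = K a.
Proof. by apply: perspectivity => //; case: a. Qed.

Let MP a : M a <> p /\ meet l1 (join Y (M a)) = R a.
Proof. by apply: perspectivity => //; [exact: meetl|case: (RP a)]. Qed.

(** The map [M] projects [l0] to [l1] from [X] and then [l1] to [linf] from [Y]; retracing both
    steps recovers [a]. *)
Let MI : injective M.
Proof.
move=> a b E; apply: KI; rewrite -(RP a).2 -(RP b).2.
by rewrite -(MP a).2 -(MP b).2 E.
Qed.

Let Ms q : inc q linf -> q <> p -> exists a, M a = q.
Proof.
move=> qi qp.
have [rp rq] := perspectivity pinf p1 Yinf Y1 qi qp.
have [sp sr] := perspectivity p1 p0 X1 X0 (meetl l1 (join Y q)) rp.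
have [a aE] := Ks (meetl _ _) sp.
by exists a; rewrite /M /R /H aE sr rq.
Qed.

Let p_H a : ~ inc p (H a). Proof. exact: (perspective_line p0 X0 (K0 a) (@Kp a)). Qed.

Let p_I : ~ inc p I.
Proof. exact: (perspective_line p1 Y1 (meetl _ _) (RP e).1). Qed.

(** Otherwise [I] would be the horizontal [H e], which passes through [Y] only if [e] is the
    origin. *)
Let X_I : ~ inc X I.
Proof.
have nXR : X <> R e by move=> E; apply: X1; rewrite E; apply: meetl.
move=> XI; have E : I = H e.
  by apply: (line_eq nXR) => //; [exact: joinr|exact: joinl|exact: meetr].
apply: noe; apply: KI; apply: (point_eq p0 (@p_H e)) => //.
  by rewrite -E; apply: joinl.
exact: joinr.
Qed.

Let D_p a : D a <> p.
Proof. by move=> E; apply: p_I; rewrite -E; apply: meetl. Qed.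

Let off_inf d : inc d I -> forall a, inc d (H a) -> ~ inc d linf.
Proof.
move=> dI a dH di; apply: X_I.
have -> // : X = d.
by apply: (point_eq pinf (@p_H a)) => //; apply: joinl.
Qed.

Let Vinf a : V a <> linf.
Proof.
move=> E; apply: (@off_inf (D a) (meetl _ _) a (meetr _ _)).
by rewrite -E; apply: joinr.
Qed.

Let V_eq a v : inc p v -> inc (D a) v -> V a = v.
Proof.
move=> pv Dv; apply: (line_eq (@D_p a)) => //; first exact: joinr.
exact: joinl.
Qed.

Let D_eq a d : inc d I -> inc d (H a) -> D a = d.
Proof.
move=> dI dH; case: (line_uniq hP (meetl I (H a)) dI (meetr _ _) dH) => // E.
by case: X_I; rewrite E; apply: joinl.
Qed.

(** [V a] meets [I] in [D a], the line from [X] to [D a] is [H a], and [H a] meets [l0] in [K a]. *)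
Let VI : injective V.
Proof.
move=> a b E; have DD : D a = D b.
  have pV : inc p (V b) by apply: joinl.
  apply: (point_eq pV p_I); [by rewrite -E; apply: joinr|exact: joinr|exact: meetl..].
have nDX : D a <> X by move=> E'; apply: X_I; rewrite -E'; apply: meetl.
have HH : H a = H b.
  have DHb : inc (D a) (H b) by rewrite DD; apply: meetr.
  exact: (line_eq nDX (meetr _ _) (joinl _ _) DHb (joinl _ _)).
apply: KI; apply: (point_eq p0 (@p_H a)) => //; first exact: joinr.
by rewrite HH; apply: joinr.
Qed.

(** The label is found by projecting the intersection of [v] and [I] from [X] to [l0]. *)
Let Vs v : inc p v -> v <> linf -> exists a, V a = v.
Proof.
move=> pv nv; pose d := meet I v.
have dp : d <> p by move=> E; apply: p_I; rewrite -E; apply: meetl.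
have di : ~ inc d linf.
  by move=> di; apply: dp; apply: (concurrent_meet nv) => //; apply: meetr.
have dX : d <> X by move=> E; apply: di; rewrite E.
have ph : ~ inc p (join X d).
  move=> ph; apply: di.
  by rewrite -(line_eq Xp (joinl X d) ph Xinf pinf).
have [|a aE] := @Ks (meet l0 (join X d)) (meetl _ _).
  by move=> E; apply: ph; rewrite -E.
have nXa : X <> K a by move=> E; apply: X0; rewrite E.
have dH : inc d (H a).
  have -> : H a = join X d; last exact: joinr.
  apply: (line_eq nXa) => //; rewrite ?aE; last exact: meetr.
    exact: joinl.
  by rewrite -aE; exact: joinr.
exists a; apply: V_eq => //; rewrite (D_eq _ dH); [exact: meetr|exact: meetl].
Qed.

Let Vo : V o = l0.
Proof. by apply: V_eq => //; rewrite (@D_eq o Y) //; [exact: joinl|exact: joinr]. Qed.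

Let Mo : M o = X.
Proof.
have nYR : Y <> R o by move=> E; apply: Y1; rewrite E; apply: meetl.
have E : join Y (R o) = H o.
  by apply: (line_eq nYR) => //; [exact: (joinr X (K o))|exact: meetr].
apply: (point_eq pinf (@p_H o)) => //; first exact: meetl.
  by rewrite -E; apply: meetr.
exact: joinl.
Qed.

Let De : D e = R e.
Proof. by apply: D_eq; [exact: joinr|exact: meetr]. Qed.

Let Ve : V e = l1.
Proof. by apply: V_eq => //; rewrite De; apply: meetl. Qed.

Let ML a : join (M a) (K o) = join Y (R a).
Proof.
have nMY : M a <> Y by move=> E; apply: Yinf; rewrite -E; apply: meetl.
exact: (line_eq nMY (joinl _ _) (joinr _ (K o)) (meetr _ _) (joinl _ _)).
Qed.

Lemma frame_coordinates : exists (S : ternary_ring)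
    (f : tpoint S -> pt P) (g : tline S -> ln P),
  [/\ bijective f, bijective g,
      forall q l, @tinc S q l <-> inc (f q) (g l),
      [/\ f PInf = p, f (PSlope (tzero S)) = X
        & f (PAff (tzero S) (tzero S)) = Y]
    & [/\ g LInf = linf, g (LVert (tzero S)) = l0 & g (LVert (tone S)) = l1]].
Proof.
have [||S [f [g]]] := coordinate_ring_exists (M := M) (V := V) noe K0 Kp KI Ks
  (fun a => meetl _ _) (fun a => (MP a).1) MI Ms (fun a => joinl p (D a))
  Vinf VI Vs Vo.
(* The point [[1,a]] is [R a], and [<a,0>] is the line from [Y] to it. *)
- by move=> a; rewrite ML Ve Mo; apply: joinr.
(* The point [[a,a]] is [D a], and the line [<1,0>] is [I]. *)
- move=> a; rewrite ML Mo.
  rewrite (_ : meet _ _ = D a); first exact: meetl.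
  have pV : inc p (V a) by apply: joinl.
  by apply: (point_eq pV (@p_H a)) => //; [exact: joinr|exact: meetr].
by rewrite Mo Ve => h; exists S, f, g.
Qed.

End Frame.

End Coordinates.

(* If [a] and [b] were the only points of [l], every line would pass through
   one of them, which forces each point of the quadrangle to be [a] or [b]. *)
Lemma third_point (P : incidence) (hP : projective_plane P) (a b : pt P) (l : ln P) :
  inc a l -> inc b l -> exists q, [/\ inc q l, q <> a & q <> b].
Proof.
move=> al bl; apply: contrapT => no.
have off q : inc q l -> q = a \/ q = b.
  move=> ql; have [|nqa] := EM (q = a); first by left.
  by right; apply: contrapT => nqb; apply: no; exists q.
have meets m : inc a m \/ inc b m.
  have [->|nlm] := EM (m = l); first by left.
  case: hP => _ /(_ m l nlm) [q [[qm ql] _]] _.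
  by case: (off q ql) => E; rewrite -E; [left|right].
case: hP => jP _ [r rP].
have rab i : r i = a \/ r i = b.
  apply: contrapT => nri.
  have nra : r i <> a by move=> E; apply: nri; left.
  have nrb : r i <> b by move=> E; apply: nri; right.
  have [ja [[ia aa] ua]] := jP _ _ nra; have [jb [[ib bb] ub]] := jP _ _ nrb.
  (* The line through [r i] and [r j] passes through [a] or [b], so it is one of the two lines
     joining [r i] to these points. *)
  have on j : inc (r j) ja \/ inc (r j) jb.
    have [<-|nij] := EM (r i = r j); first by left.
    have [m [[im jm] _]] := jP _ _ nij.
    by case: (meets m) => hm; [left; rewrite (ua m)|right; rewrite (ub m)].
  have col j k m : i <> j -> j <> k -> i <> k ->
      inc (r i) m -> inc (r j) m -> inc (r k) m -> False.
    by move=> ij jk ik im jm km; apply: (rP i j k) => //; exists m => _ [[->|->]|->].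
  (* Pigeonhole: of the three other points, two share one of the lines [ja], [jb], and are collinear
     with [r i]. *)
  have two j k h : i <> j -> j <> k -> i <> k -> i <> h -> j <> h -> k <> h -> False.
    move=> ij jk ik ih jh kh.
    by case: (on j) => oj; case: (on k) => ok; case: (on h) => oh;
      solve [exact: (col j k _ ij jk ik ia oj ok)|exact: (col j k _ ij jk ik ib oj ok)
            |exact: (col j h _ ij jh ih ia oj oh)|exact: (col j h _ ij jh ih ib oj oh)
            |exact: (col k h _ ik kh ih ia ok oh)|exact: (col k h _ ik kh ih ib ok oh)].
  by case: (i) two => [[|[|[|[|//]]]] hi] two;
    [apply: (two (@Ordinal 4 1 isT) (@Ordinal 4 2 isT) (@Ordinal 4 3 isT))
    |apply: (two (@Ordinal 4 0 isT) (@Ordinal 4 2 isT) (@Ordinal 4 3 isT))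
    |apply: (two (@Ordinal 4 0 isT) (@Ordinal 4 1 isT) (@Ordinal 4 3 isT))
    |apply: (two (@Ordinal 4 0 isT) (@Ordinal 4 1 isT) (@Ordinal 4 2 isT))].
have rl i : inc (r i) l by case: (rab i) => ->.
apply: (rP (@Ordinal 4 0 isT) (@Ordinal 4 1 isT) (@Ordinal 4 2 isT)) => //.
by exists l => _ [[->|->]|->].
Qed.

(** * Choosing the frame of a net and closing the equivalences *)

Lemma total_join (P : incidence) (hP : projective_plane P) (a0 b0 : pt P) :
  a0 <> b0 -> exists join : pt P -> pt P -> ln P,
    (forall a b, inc a (join a b)) /\ (forall a b, inc b (join a b)).
Proof.
(* The pair [a0], [b0] serves equal arguments: one of the two differs from the given point, so some
   line passes through that point. *)
move=> n0; have [|j jP] := @choice (pt P * pt P) (ln P)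
    (fun ab l => inc ab.1 l /\ inc ab.2 l).
  have jex (a b : pt P) : a <> b -> exists l, inc a l /\ inc b l.
    by have [jP _ _] := hP; move=> n; have [l [H _]] := jP _ _ n; exists l.
  move=> [a b] /=; have [->|/jex //] := EM (a = b).
  have [->|/jex [l [bl _]]] := EM (b = a0); last by exists l.
  by have [l [al _]] := jex _ _ n0; exists l.
by exists (fun a b => j (a, b)); split=> a b; case: (jP (a, b)).
Qed.

Lemma total_meet (P : incidence) (hP : projective_plane P) (l0 m0 : ln P) :
  l0 <> m0 -> exists meet : ln P -> ln P -> pt P,
    (forall l m, inc (meet l m) l) /\ (forall l m, inc (meet l m) m).
Proof.
move=> n0; have [|j jP] := @choice (ln P * ln P) (pt P)
    (fun lm a => inc a lm.1 /\ inc a lm.2).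
  have mex (l m : ln P) : l <> m -> exists a, inc a l /\ inc a m.
    by have [_ mP _] := hP; move=> n; have [a [H _]] := mP _ _ n; exists a.
  move=> [l m] /=; have [->|/mex //] := EM (l = m).
  have [->|/mex [a [am _]]] := EM (m = l0); last by exists a.
  by have [a [al _]] := mex _ _ n0; exists a.
by exists (fun l m => j (l, m)); split=> l m; case: (jP (l, m)).
Qed.

Lemma net_subloop (P : incidence) (hP : projective_plane P)
    (Q : Type) (mul : Q -> Q -> Q) (hQ : is_quasigroup mul) (g0 h0 : Q) :
  has_net P mul ->
  exists T : ternary_ring, coordinatizes T P /\
  exists (S : set T) (clS : op_closed (@tadd T) S) (a b c : Q -> {x | S x}),
    [/\ is_loop (sub_op clS), [/\ bijective a, bijective b & bijective c],
        forall x y, sub_op clS (a x) (b y) = c (mul x y),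
        forall x, a x = c (mul x h0) & forall y, b y = c (mul g0 y)].
Proof.
move=> [p [l [F hN]]]; have [lI pl FI Fl _] := hN.
have nl i j : i != j -> l i <> l j by move=> n /lI/eqP; apply/negP.
have [Xl Xp] := Fl i1 g0; have [Yl Yp] := Fl i2 h0.
have [join [jl jr]] := total_join hP Xp.
have [meet [ml mr]] := total_meet hP (nl i1 i2 isT).
(* The unit is any further point of [l i2]; it is taken from the plane because the net may have only
   one point on that line. *)
have [e [el enp enY]] := third_point hP (pl i2) Yl.
have [|T [f [g [[f' fK f'K] [g' gK g'K] H]]]] :=
  @frame_coordinates P hP join meet jl jr ml mr p (l i1) (l i2) (pl i1) (pl i2)
    (nl i1 i2 isT) (l i3) _ _ (pl i3) (nl i1 i3 isT) (nl i2 i3 isT) Xl Xp Yl Yp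
    (exist _ e (conj el enp)).
  by move=> /(congr1 sval) /= /esym.
move=> [fp fX fY] [gi g0' g1].
exists T; split.
  by apply: isom_incidence_sym; exists f, g; split; [exists f'|exists g'|].
have H' q m : inc q m <-> @inc (tplane T) (f' q) (g' m) by rewrite /= H f'K g'K.
have f'B : bijective f' by exists f.
have g'B : bijective g' by exists g.
have := isom_net (P' := tplane T) f'B g'B H' hN.
rewrite -{1}fp fK => hN'.
apply: (tplane_net_subloop hQ hN') => /=.
- by rewrite -gi gK.
- by rewrite -g0' gK.
- by rewrite -g1 gK.
- by rewrite -fX fK.
- by rewrite -fY fK.
Qed.

Lemma net_isotopic_subloop (P : incidence) (hP : projective_plane P)
    (Q : Type) (mul : Q -> Q -> Q) (hQ : is_quasigroup mul) :
  has_net P mul -> exists T : ternary_ring, coordinatizes T P /\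
    exists (S : set T) (clS : op_closed (@tadd T) S),
      is_loop (sub_op clS) /\ isotopic mul (sub_op clS).
Proof.
have [[q] _ _] := hQ => /(net_subloop hP hQ q q).
move=> [T [hT [S [clS [a [b [c [hl [aB bB cB] H _ _]]]]]]]].
by exists T; split=> //; exists S, clS; split=> //; exists a, b, c.
Qed.

Lemma net_isomorphic_subloop (P : incidence) (hP : projective_plane P)
    (Q : Type) (mul : Q -> Q -> Q) (hQ : is_loop mul) :
  has_net P mul -> exists T : ternary_ring, coordinatizes T P /\
    exists (S : set T) (clS : op_closed (@tadd T) S),
      is_loop (sub_op clS) /\ isomorphic mul (sub_op clS).
Proof.
have [hq [e eP]] := hQ => /(net_subloop hP hq e e).
move=> [T [hT [S [clS [a [b [c [hl [aB bB cB] H ac bc]]]]]]]].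
exists T; split=> //; exists S, clS; split=> //; exists c => // x y.
by rewrite -H ac bc; case: (eP x) => _ ->; case: (eP y) => ->.
Qed.

Theorem theorem4p4 (P : incidence) (hP : projective_plane P)
    (Q : Type) (mul : Q -> Q -> Q) (hQ : is_quasigroup mul) :
  [<-> (* a *) embeds_as_points (L0_rank mul) P;
       (* b *) embeds_as_dual_affine_3net mul P;
       (* c *) embeds_as_lines (L0_rank mul) (dual P);
       (* d *) embeds_as_affine_3net mul (dual P);
       (* e *) exists T : ternary_ring, coordinatizes T P /\
                 exists (S : set T) (clS : op_closed (@tadd T) S),
                   is_quasigroup (sub_op clS) /\ isostrophic mul (sub_op clS);
       (* f *) exists T : ternary_ring, coordinatizes T P /\
                 exists (S : set T) (clS : op_closed (@tadd T) S),
                   is_loop (sub_op clS) /\ isotopic mul (sub_op clS)]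
  /\ (is_loop mul ->
       (embeds_as_points (L0_rank mul) P <->
        exists T : ternary_ring, coordinatizes T P /\
          exists (S : set T) (clS : op_closed (@tadd T) S),
            is_loop (sub_op clS) /\ isomorphic mul (sub_op clS))).
Proof.
have hq : inhabited Q by case: hQ.
(* A subloop is a subquasigroup, and isotopy is isostrophy with the trivial conjugation. *)
have isotopic_net : (exists T : ternary_ring, coordinatizes T P /\
    exists (S : set T) (clS : op_closed (@tadd T) S),
      is_loop (sub_op clS) /\ isotopic mul (sub_op clS)) -> has_net P mul.
  move=> [T [hT [S [clS [[hS _] hi]]]]]; apply: subquasigroup_has_net.
  exists T; split=> //; exists S, clS; split=> //.
  exact: isotopic_isostrophic.
split.
  (* The six conditions are proved in a cycle, every arrow passing through a net. *)
  tfae.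
  - by move/(L0_has_net hP hq)/(net_dual_affine_3net hP).
  - move/(dual_affine_3net_has_net hP)/(has_net_L0 hP).
    (* Once [P] is in constructor form, its double dual is the plane itself by conversion, so (c) is
       (a). *)
    by case: (P).
  - have -> : embeds_as_lines (L0_rank mul) (dual P) = embeds_as_points (L0_rank mul) P.
      by case: (P).
    move/(L0_has_net hP hq)/(net_dual_affine_3net hP).
    by case: (P) => pT lT i /affine_3net_dual_iff.
  - have d_b : embeds_as_affine_3net mul (dual P) -> embeds_as_dual_affine_3net mul P.
      by case: (P) => pT lT i /affine_3net_dual_iff.
    move/d_b/(dual_affine_3net_has_net hP)/(net_isotopic_subloop hP hQ).
    move=> [T [hT [S [clS [[hS _] hi]]]]].
    exists T; split=> //; exists S, clS; split=> //.
    exact: isotopic_isostrophic.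
  - by move/subquasigroup_has_net/(net_isotopic_subloop hP hQ).
  - by move/isotopic_net/(has_net_L0 hP).
move=> hl; split; first by move/(L0_has_net hP hq)/(net_isomorphic_subloop hP hl).
move=> [T [hT [S [clS [hS /isomorphic_isotopic hi]]]]].
by apply/(has_net_L0 hP)/isotopic_net; exists T; split=> //; exists S, clS.
Qed.
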